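(* Let $n,r,d$ be positive integers and let $S$ be a set of $n$ points in $\mathbb{R}^d$. Assign to each point of $S$ a label from $\{1,\dots,r\}$, uniformly and independently, and let $P$ be the resulting random partition of $S$ (the parts being the nonempty label classes). Then the probability that $P$ is a Tverberg partition of $S$ into $r$ parts whose degree in $G_T[S,r]$ equals $n(r-1)$ is at least \[1-r^{(r-1)(d+1)}\,n^{(r-1)(d+1)}\exp\!\left(\frac{-2(n-r)^2}{nr^2}\right).\]
   Context: A partition of a finite set $S$ into $r$ parts is a collection of $r$ nonempty pairwise disjoint subsets $P_1,\dots,P_r$ (unordered) whose union is $S$. For a finite $S\subset\mathbb{R}^d$, a Tverberg partition of $S$ into $r$ parts is a partition $P_1,\dots,P_r$ of $S$ into $r$ parts with $\bigcap_{j=1}^r\operatorname{conv}(P_j)\neq\emptyset$. For two partitions $P,P'$ of $S$, the partition distance $D(P,P')$ is the minimum number of elements of $S$ that must be removed so that $P$ and $P'$ restricted to the remaining elements coincide. The Tverberg $r$-partition graph $G_T[S,r]$ has as vertices all Tverberg partitions of $S$ into $r$ parts, with an edge between $P$ and $P'$ if and only if $D(P,P')=1$. *)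

(* Defs.v *)
From mathcomp Require Import all_boot all_order all_algebra.
From mathcomp Require Import boolp reals sequences exp.
Set Implicit Arguments. Unset Strict Implicit. Unset Printing Implicit Defensive.
Import Order.TTheory GRing.Theory Num.Theory.
Local Open Scope ring_scope.

(* A point set S of n points in R^d is given by an injective map p : 'I_n -> 'rV[R]_d;
   partitions of S are represented as partitions of the index set 'I_n
   (a {set {set 'I_n}} satisfying finset's [partition], i.e. pairwise disjoint,
   nonempty blocks covering 'I_n). *)

Section Tverberg.
Variables (R : realType) (n d : nat).

Definition in_conv (p : 'I_n -> 'rV[R]_d) (A : {set 'I_n}) (x : 'rV[R]_d) : Prop :=
  exists w : 'I_n -> R,
    [/\ forall i, 0 <= w i,
        forall i, i \notin A -> w i = 0,
        \sum_i w i = 1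
      & x = \sum_i w i *: p i].

Definition is_partition_r (r : nat) (P : {set {set 'I_n}}) : bool :=
  partition P [set: 'I_n] && (#|P| == r).

Definition tverberg_partition (p : 'I_n -> 'rV[R]_d) (r : nat) (P : {set {set 'I_n}}) : Prop :=
  is_partition_r r P /\ exists x : 'rV[R]_d, forall B, B \in P -> in_conv p B x.

Definition restrict_part (P : {set {set 'I_n}}) (Y : {set 'I_n}) : {set {set 'I_n}} :=
  [set B :&: Y | B in P] :\ set0.

(* partition distance: minimum number of removed elements so that restrictions coincide
   (removing everything always works, hence the default n) *)
Definition part_dist (P P' : {set {set 'I_n}}) : nat :=
  \big[minn/n]_(X : {set 'I_n} | restrict_part P (~: X) == restrict_part P' (~: X)) #|X|.

Definition tverberg_degree (p : 'I_n -> 'rV[R]_d) (r : nat) (P : {set {set 'I_n}}) : nat :=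
  #|[set P' : {set {set 'I_n}} | `[< tverberg_partition p r P' >] && (part_dist P P' == 1%N)]|.

End Tverberg.

Definition label_partition (n r : nat) (f : {ffun 'I_n -> 'I_r}) : {set {set 'I_n}} :=
  [set [set i | f i == j] | j : 'I_r] :\ set0.

Definition prob_good (R : realType) (n d r : nat) (p : 'I_n -> 'rV[R]_d) : R :=
  (#|[set f : {ffun 'I_n -> 'I_r} |
       `[< tverberg_partition p r (label_partition f)
           /\ tverberg_degree p r (label_partition f) = (n * (r - 1))%N >]]|)%:R
  / (r ^ n)%:R.

(* Main.v *)
Require Import Defs.
From mathcomp Require Import all_boot all_order all_algebra.
From mathcomp Require Import boolp reals sequences exp.
From mathcomp Require Import topology normedtype derive realfun.
From mathcomp Require Import ring lra zify.
Import Order.TTheory GRing.Theory Num.Theory.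
Import numFieldNormedType.Exports.
Set Implicit Arguments. Unset Strict Implicit. Unset Printing Implicit Defensive.
Local Open Scope ring_scope.

(* Sarkaria's tensor trick maps the point p_i with label j to a vector y(i,j) of dimension
   D = (r-1)(d+1), so that sum_j y(i,j) = 0 and the classes of f have intersecting convex
   hulls as soon as 0 is a convex combination of the y(i, f i). Call f robust if this
   survives the deletion of any single point; then every relabelling of one point is again
   a Tverberg partition, and these n(r-1) relabellings are exactly the neighbours of f. If
   f is not robust, Gordan's theorem gives a closed half-space {y | y.u <= 0} containing at
   most one of the y(i, f i), although it contains some y(i,j) for every i. For a fixed
   half-space this has probability at most exp(-2(n-r)^2/(n r^2)) by Hoeffding's inequality,
   and by Sauer's lemma only (nr)^D traces of half-spaces on the rn vectors y(i,j) occur. *)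

(** * Shattered sets and Sauer's lemma *)

Definition shatters (T : finType) (F : {set {set T}}) (A : {set T}) : bool :=
  [forall B : {set T}, (B \subset A) ==> [exists Z in F, Z :&: A == B]].

Lemma shattersP (T : finType) (F : {set {set T}}) (A : {set T}) :
  reflect (forall B : {set T}, B \subset A -> exists2 Z, Z \in F & Z :&: A = B)
          (shatters F A).
Proof.
apply: (iffP forallP) => [h B sBA | h B].
  have /implyP/(_ sBA)/existsP[Z /andP[ZF /eqP <-]] := h B.
  by exists Z.
apply/implyP => /h[Z ZF <-]; apply/existsP; exists Z.
by rewrite ZF eqxx.
Qed.

(* Induction on #|F|: splitting F by membership of a point x, a set shattered by both
   halves is shattered by F together with its extension by x. *)
Lemma card_le_shattered (T : finType) (F : {set {set T}}) :
  (#|F| <= #|[set A | shatters F A]|)%N.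
Proof.
have [m] := ubnP #|F|; elim: m F => // m IH F Fm.
have [F1|] := leqP #|F| 1.
  have [->|[Z ZF]] := set_0Vmem F; first by rewrite cards0.
  apply: (leq_trans F1); rewrite card_gt0; apply/set0Pn; exists set0.
  rewrite inE; apply/shattersP => B; rewrite subset0 => /eqP ->.
  by exists Z => //; rewrite setI0.
case/card_gt1P => Z1 [Z2] [Z1F Z2F neqZ].
have [x xZ] : exists x, (x \in Z1) != (x \in Z2).
  apply/existsP; apply: contraNT neqZ; rewrite negb_exists => /forallP h.
  by apply/eqP/setP => x; apply/eqP; rewrite -[_ == _]negbK h.
pose G b := [set Z in F | (x \in Z) == b].
have GF b : G b \subset F by apply/subsetP => Z; rewrite inE => /andP[].
have Gprop b : (#|G b| < m)%N.
  rewrite (leq_trans _ (Fm : (#|F| <= m)%N)) //; apply: proper_card.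
  rewrite properE GF; apply/subsetPn.
  have [h|h] := eqVneq (x \in Z1) b.
    by exists Z2 => //; rewrite inE Z2F /= -h eq_sym.
  by exists Z1 => //; rewrite inE Z1F.
have cF : #|F| = (#|G true| + #|G false|)%N.
  rewrite -cardsUI (_ : G true :|: G false = F); last first.
    apply/setP => Z; rewrite !inE -andb_orr; case: (x \in Z); rewrite ?andbT //=.
  rewrite (_ : G true :&: G false = set0) ?cards0 ?addn0 //.
  by apply/setP => Z; rewrite !inE; case: (x \in Z); rewrite ?andbF.
have xG b A : shatters (G b) A -> x \notin A.
  move=> /shattersP h; apply/negP => xA.
  (* All members of [G b] agree on whether they contain [x], so none of them cuts out a trace with
     the opposite value at [x]. *)
  have [Z + ZA] := h (if b then set0 else [set x])
    ltac:(by case: b {h}; rewrite ?sub0set ?sub1set).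
  rewrite inE => /andP[_ /eqP xZb]; move/setP/(_ x): ZA.
  by rewrite inE xA xZb; case: b {h xZb}; rewrite ?inE ?eqxx.
pose S b := [set A | shatters (G b) A].
rewrite cF; apply: (leq_trans (leq_add (IH _ (Gprop true)) (IH _ (Gprop false)))).
rewrite -/(S true) -/(S false) -cardsUI.
have inj : {in S true :&: S false &, injective (fun A => x |: A)}.
  move=> A B; rewrite !inE => /andP[/xG xA _] /andP[/xG xB _] e.
  by rewrite -(setU1K xA) e setU1K.
rewrite -(card_in_imset inj) -cardsUI.
rewrite (_ : _ :&: [set x |: A | A in _] = set0); last first.
  apply/setP => A; rewrite in_set0; apply/negP => /setIP[AS /imsetP[B _ AE]].
  have : x \notin A by move: AS; rewrite !inE => /orP[] /xG.
  by rewrite AE setU11.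
rewrite cards0 addn0; apply: subset_leq_card; apply/subsetP => A.
case/setUP => [|/imsetP[B + ->]].
  move=> h; rewrite inE; apply/shattersP => B sBA.
  have [b /shattersP /(_ B sBA)[Z ZG ZA]] : exists b, shatters (G b) A.
    by move: h; rewrite !inE => /orP[]; [exists true | exists false].
  by exists Z => //; apply: (subsetP (GF b)).
rewrite !inE => /andP[h1 h0]; apply/shattersP => C sC.
have xB := xG _ _ h1.
(* To cut [C] out of [x |: B], use the half whose members agree with [C] at [x]; either half
   shatters [B]. *)
have [Z] : exists2 Z, Z \in G (x \in C) & Z :&: B = C :\ x.
  have : C :\ x \subset B by rewrite subDset.
  by case: (x \in C); [apply/(shattersP _ _ h1)|apply/(shattersP _ _ h0)].
rewrite inE => /andP[ZF /eqP xZC] ZB; exists Z => //.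
apply/setP => z; rewrite !inE; have [->|zx] := eqVneq z x; first by rewrite andbT.
by move/setP/(_ z): ZB; rewrite !inE zx.
Qed.

Lemma card_subsets_le (T : finType) (D : nat) :
  #|[set A : {set T} | (#|A| <= D)%N]| = (\sum_(k < D.+1) 'C(#|T|, k))%N.
Proof.
elim: D => [|D IH].
  rewrite big_ord_recl big_ord0 bin0 addn0 -(cards1 (set0 : {set T})); congr #|pred_of_set _|.
  by apply/setP => A; rewrite !inE leqn0 cards_eq0.
rewrite big_ord_recr /= -IH -card_draws.
rewrite -cardsUI [X in (_ + X)%N](_ : _ = 0%N) ?addn0.
  by congr #|pred_of_set _|; apply/setP => A; rewrite !inE leq_eqVlt orbC ltnS.
by apply/eqP; rewrite cards_eq0; apply/eqP/setP => A; rewrite !inE; lia.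
Qed.

(** Induction starting at exponent 2, since at exponent 1 the sum is [N + 1]. Passing from [D] to
    [D + 1] adds at most [N ^ D * (N - 1)]: the binomial coefficient is bounded by a falling
    factorial, whose second factor is [N - 1]. *)
Lemma sum_bin_le_expn (N D : nat) :
  (1 < N)%N -> (1 < D)%N -> (\sum_(k < D.+1) 'C(N, k) <= N ^ D)%N.
Proof.
move=> N1; case: D => [//|[//|D]] _; elim: D => [|D IH].
  rewrite !big_ord_recr big_ord0 /= bin0 bin1 add0n.
  have := bin2 N; have := mul_bin_diag N 1; rewrite bin1.
  by case: N N1 => [//|[//|N]] _ /=; nia.
rewrite big_ord_recr /=; apply: (leq_trans (leq_add IH (leqnn _))).
have le : ('C(N, D.+3) <= N ^ D.+2 * (N - 1))%N.
  apply: (@leq_trans (N ^_ D.+3)); first by rewrite -bin_ffact leq_pmulr ?fact_gt0.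
  rewrite ffactnS -subn1 expnS -mulnA leq_mul2l; apply/orP; right.
  rewrite ffactnS mulnC leq_mul2r; apply/orP; right.
  elim: (D.+1) (N - 1).-1 (leq_trans (leq_pred _) (leq_subr 1 N)) => [//|k IHk] m mN.
  rewrite ffactnS expnS leq_mul // IHk //; lia.
by rewrite (expnS N D.+2); nia.
Qed.

(** * Linear functionals, Gordan's theorem, and sets shattered by half-spaces *)

Definition dot (R : pzRingType) (D : nat) (x : 'rV[R]_D) (u : 'cV[R]_D) : R := (x *m u) 0 0.

Lemma dotDr (R : pzRingType) D (x : 'rV[R]_D) u v : dot x (u + v) = dot x u + dot x v.
Proof. by rewrite /dot mulmxDr mxE. Qed.

Lemma dotDl (R : pzRingType) D (x y : 'rV[R]_D) u : dot (x + y) u = dot x u + dot y u.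
Proof. by rewrite /dot mulmxDl mxE. Qed.

Lemma dotZl (R : pzRingType) D a (x : 'rV[R]_D) u : dot (a *: x) u = a * dot x u.
Proof. by rewrite /dot -scalemxAl mxE. Qed.

Lemma dotZr (R : comPzRingType) D a (x : 'rV[R]_D) u : dot x (a *: u) = a * dot x u.
Proof. by rewrite /dot -scalemxAr mxE. Qed.

Lemma dot_suml (R : pzRingType) D (I : Type) (s : seq I) (P : pred I) (x : I -> 'rV[R]_D) u :
  dot (\sum_(i <- s | P i) x i) u = \sum_(i <- s | P i) dot (x i) u.
Proof. by rewrite /dot mulmx_suml summxE. Qed.

Lemma dot0l (R : pzRingType) D (u : 'cV[R]_D) : dot 0 u = 0.
Proof. by rewrite /dot mul0mx mxE. Qed.

Lemma dot_tr_gt0 (R : realDomainType) D (x : 'rV[R]_D) : x != 0 -> 0 < dot x x^T.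
Proof.
move=> x0; rewrite lt_neqAle eq_sym; apply/andP; split; last first.
  by rewrite /dot mxE sumr_ge0 // => i _; rewrite mxE -expr2 sqr_ge0.
apply: contraNneq x0; rewrite /dot mxE => /eqP.
rewrite psumr_eq0 => [/allP h|i _]; last by rewrite mxE -expr2 sqr_ge0.
apply/eqP/rowP => i; have := h i (mem_index_enum _).
by rewrite !mxE mulf_eq0 orbb => /eqP.
Qed.

(** Supplies the small perturbations in [gordan]: [1 + S] exceeds every ratio [b i / c i], so its
    inverse is a suitable [e]. *)
Lemma exists_small_scale (R : realFieldType) (T : finType) (s : seq T) (b c : T -> R) :
  (forall i, i \in s -> 0 < b i) -> (forall i, i \in s -> 0 < c i) ->
  exists2 e, 0 < e & forall i, i \in s -> e * b i < c i.
Proof.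
move=> b0 c0; pose S := \sum_(j | j \in s) b j / c j.
have S0 : 0 <= S by apply: sumr_ge0 => j js; rewrite divr_ge0 // ltW ?b0 ?c0.
exists (1 + S)^-1; first by rewrite invr_gt0; lra.
move=> i si; rewrite mulrC ltr_pdivrMr; last by lra.
rewrite mulrC -ltr_pdivrMr ?c0 //.
suff : b i / c i <= S by lra.
rewrite /S (bigD1 i) //= lerDl sumr_ge0 // => j /andP[js _].
by rewrite divr_ge0 // ltW ?b0 ?c0.
Qed.

(* In the induction step, if u is positive on s but dot (y m) u = - a < 0,
   the vectors y i (i in s) are slid along y m into the hyperplane orthogonal to u. *)
Lemma gordan (R : realFieldType) (D : nat) (T : finType) (s : seq T) (y : T -> 'rV[R]_D) :
  (exists u, forall i, i \in s -> 0 < dot (y i) u) \/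
  (exists w : T -> R, [/\ forall i, 0 <= w i, forall i, i \notin s -> w i = 0,
      0 < \sum_i w i & \sum_i w i *: y i = 0]).
Proof.
elim: s y => [|m s IH] y; first by left; exists 0.
case: (IH y) => [[u us]|[w [w0 ws wS wy]]]; last first.
  right; exists w; split=> // i; rewrite inE negb_or => /andP[_]; exact: ws.
have [um|um|um] := ltrgtP 0 (dot (y m) u).
- by left; exists u => i; rewrite inE => /predU1P[->|/us].
- pose a := - dot (y m) u.
  pose z i := a *: y i + dot (y i) u *: y m.
  have a0 : 0 < a by rewrite oppr_gt0.
  case: (IH z) => [[v vs]|[w [w0 ws wS wz]]]; last first.
    have bS : 0 < \sum_i w i * dot (y i) u.
      rewrite lt_neqAle eq_sym; apply/andP; split; last first.
        apply: sumr_ge0 => i _; have [/us/ltW h|/ws ->] := boolP (i \in s).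
          exact: mulr_ge0.
        by rewrite mul0r.
      apply: contraTneq wS => e; rewrite -leNgt.
      rewrite big1 // => i _; have [si|/ws //] := boolP (i \in s).
      have h j : j \in index_enum T -> true -> 0 <= w j * dot (y j) u.
        have [/us/ltW ?|/ws ->] := boolP (j \in s); last by rewrite mul0r.
        by rewrite mulr_ge0.
      have := e; move/eqP; rewrite psumr_eq0 => [|j _]; last exact: h (mem_index_enum _) _.
      move/allP/(_ i (mem_index_enum _)); rewrite implyTb mulf_eq0.
      by by rewrite (gt_eqF (us i si)) orbF => /eqP.
    (* Expanding each [z i] in the dependency yields these coefficients; the second summand collects
       the multiples of [y m]. *)
    right; exists (fun i => a * w i + (i == m)%:R * \sum_i w i * dot (y i) u); split.
    + by move=> i; rewrite addr_ge0 // mulr_ge0 ?ler0n // ltW.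
    + move=> i; rewrite inE negb_or => /andP[/negPf -> /ws ->].
      by rewrite mulr0 mul0r addr0.
    + rewrite big_split /= -mulr_sumr -mulr_suml ltr_wpDl //.
        by rewrite mulr_ge0 // ltW.
      rewrite mulr_gt0 // (bigD1 m) //= eqxx big1 ?addr0 ?ltr01 //.
      by move=> i /negPf ->.
    + under eq_bigr do rewrite scalerDl.
      rewrite big_split /= [X in _ + X](bigD1 m) //= eqxx mul1r.
      rewrite [X in _ + (_ + X)]big1 ?addr0; last first.
        by move=> i /negPf ->; rewrite mul0r scale0r.
      rewrite -[RHS]wz scaler_suml -big_split /=; apply: eq_bigr => i _.
      by rewrite scalerDr !scalerA mulrC.
  have [e e0 es] := exists_small_scale us vs.
  (* On [y m] this functional has the value [e * a], and on [y i] the value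
     [dot (z i) v - e * dot (y i) u], positive by the choice of [e]. *)
  left; exists (a *: v + (dot (y m) v - e) *: u) => i.
  rewrite inE dotDr !dotZr => /predU1P[->|si].
    have -> : dot (y m) u = - a by rewrite opprK.
    by rewrite (_ : _ + _ = e * a) ?mulr_gt0 //; ring.
  have := es i si; rewrite /z dotDl !dotZl => h; lra.
- have [ym|ym] := eqVneq (y m) 0.
    right; exists (fun i => (i == m)%:R); split.
    + by move=> i; rewrite ler0n.
    + by move=> i; rewrite inE negb_or => /andP[/negPf ->].
    + by rewrite (bigD1 m) //= eqxx big1 ?addr0 ?ltr01 // => i /negPf ->.
    + rewrite (bigD1 m) //= ym scaler0 add0r big1 // => i /negPf ->.
      by rewrite scale0r.
  (* Here [u] vanishes on [y m], and tilting it slightly towards [y m] makes that value positive.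
     Adding 1 to the absolute value gives the strictly positive quantity that is to be scaled. *)
  have [e e0 es] := @exists_small_scale _ _ s (fun i => 1 + `|dot (y i) (y m)^T|)
    (fun i => dot (y i) u) (fun i _ => ltr_pwDl ltr01 (normr_ge0 _)) us.
  left; exists (u + e *: (y m)^T) => i; rewrite inE dotDr dotZr => /predU1P[->|si].
    by rewrite -um add0r mulr_gt0 // dot_tr_gt0.
  have := es i si; have := ler_norm (- dot (y i) (y m)^T); rewrite normrN.
  set c := dot _ (y m)^T; set c' := `|c| => h h'; nra.
Qed.

(** More than [D] vectors have a nontrivial dependency [c]. Shattering yields a half-space
    containing exactly the vectors with nonnegative coefficient; applying its functional to the
    dependency makes every term nonpositive, and strictly negative where the coefficient is
    negative. Hence no dependency has a negative coefficient, and using this for both [c] and [- c]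
    forces [c = 0]. *)
Lemma card_shattered_halfspaces (R : realFieldType) (D : nat) (T : finType)
    (y : T -> 'rV[R]_D) (A : {set T}) :
  (forall B : {set T}, B \subset A ->
     exists u, forall t, t \in A -> (dot (y t) u <= 0) = (t \in B)) ->
  (#|A| <= D)%N.
Proof.
move=> sh; rewrite leqNgt; apply/negP => DA.
pose M := \matrix_(i < #|A|) y (enum_val i).
have : kermx M != 0.
  by rewrite kermx_eq0 /row_free neq_ltn (leq_ltn_trans (rank_leq_col M)).
case/rowV0Pn => c /sub_kermxP cM c0.
have cy : \sum_(i < #|A|) c 0 i *: y (enum_val i) = 0.
  rewrite -[RHS]cM mulmx_sum_row; apply: eq_bigr => i _.
  by rewrite rowK.
have key (c' : 'rV[R]_#|A|) : \sum_i c' 0 i *: y (enum_val i) = 0 ->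
    forall i, 0 <= c' 0 i.
  move=> cy' i; rewrite leNgt; apply/negP => ci.
  have [u hu] := sh [set enum_val j | j in [pred j | 0 <= c' 0 j]] ltac:(
    by apply/subsetP => t /imsetP[j _ ->]; exact: enum_valP).
  have hu' j : (dot (y (enum_val j)) u <= 0) = (0 <= c' 0 j).
    rewrite hu ?enum_valP //; apply/imsetP/idP => [[k kc /enum_val_inj ->] //|h].
    by exists j.
  have neg j : c' 0 j * dot (y (enum_val j)) u <= 0.
    have [cj|cj] := lerP 0 (c' 0 j); first by rewrite mulr_ge0_le0 // hu'.
    by rewrite mulr_le0_ge0 // ltW // ltNge hu' -ltNge.
  have := dot_suml (index_enum _) xpredT (fun i => c' 0 i *: y (enum_val i)) u.
  rewrite cy' dot0l => /esym/eqP; apply/negP; rewrite lt_eqF //.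
  rewrite (bigD1 i) //= dotZl ltr_nwDl //.
    by rewrite nmulr_rlt0 // ltNge hu' -ltNge.
  by apply: sumr_le0 => j _; rewrite dotZl.
case/eqP: c0; apply/rowP => i; rewrite mxE; apply/le_anti; rewrite key // andbT.
have := key (- c) _ i; rewrite mxE oppr_ge0; apply.
under eq_bigr do rewrite mxE scaleNr.
by rewrite sumrN cy oppr0.
Qed.

(** * Hoeffding's inequality and the tail bound for a fixed pattern *)

Lemma nonneg_of_derive (R : realType) (f df : R -> R) :
  (forall x, is_derive x (1 : R) f (df x)) -> (forall x, 0 <= x -> 0 <= df x) ->
  f 0 = 0 -> forall x, 0 <= x -> 0 <= f x.
Proof.
move=> fdf df0 f0 x x0; rewrite -f0.
apply: (@ger0_derive1_ndecry _ f 0) => // [z|].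
- rewrite in_itv /= andbT => z0; rewrite derive1E (@derive_val _ _ _ _ _ _ _ (fdf z)).
  exact/df0/ltW.
- apply/continuous_subspaceT => z; apply/differentiable_continuous/derivable1_diffP.
  exact: (@ex_derive _ _ _ _ _ _ _ (fdf z)).
Qed.

(* The derivative of the difference of logarithms is again handled by differentiation: the
   Bernoulli variance t (1 - t) is at most 1/4. *)
Lemma hoeffding_bernoulli (R : realType) (q x : R) : 0 < q -> q <= 1 -> 0 <= x ->
  1 - q + q * expR (- x) <= expR (- q * x + x ^+ 2 / 8).
Proof.
move=> q0 q1 x0.
pose Z (s : R) := 1 - q + q * expR (- s).
have Z0 s : 0 < Z s by rewrite /Z; have := expR_gt0 (- s); nra.
have dE (s : R) : is_derive s (1 : R) (expR \o -%R) (expR (- s) * -1).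
  exact: is_derive1_comp.
have dZ (s : R) : is_derive s (1 : R) Z (0 + q *: (expR (- s) * -1)).
  exact: (is_deriveD (is_derive_cst (1 - q) s (1 : R)) (is_deriveZ q (dE s))).
have d1 (s : R) : is_derive s (1 : R) (fun s => - q + 4^-1 * s + q * expR (- s) / Z s)
    (4^-1 - q * expR (- s) / Z s + (q * expR (- s) / Z s) ^+ 2).
  have := is_deriveD (is_deriveD (is_derive_cst (- q) s (1 : R))
      (is_deriveZ 4^-1 (is_derive_id s (1 : R))))
    (is_deriveM (is_deriveZ q (dE s)) (is_deriveV (lt0r_neq0 (Z0 s)) (dZ s))).
  move=> h; apply: (is_derive_eq h).
  by rewrite /GRing.scale /= -[_ *: expR _]/(_ * _); have := Z0 s => /lt0r_neq0 ?; field.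
have d2 (s : R) : is_derive s (1 : R) (fun s => - q * s + 8^-1 * (s * s) - ln (Z s))
    (- q + 4^-1 * s + q * expR (- s) / Z s).
  have := is_deriveB (is_deriveD (is_deriveZ (- q) (is_derive_id s (1 : R)))
      (is_deriveZ 8^-1 (is_deriveM (is_derive_id s (1 : R)) (is_derive_id s (1 : R)))))
    (is_derive1_comp (is_derive1_ln (Z0 s)) (dZ s)).
  move=> h; apply: (is_derive_eq h).
  by rewrite /GRing.scale /=; have := Z0 s => /lt0r_neq0 ?; field.
have g1 (s : R) : 0 <= s -> 0 <= - q + 4^-1 * s + q * expR (- s) / Z s.
  apply: (nonneg_of_derive d1) => [t _|]; last first.
    by rewrite /Z oppr0 expR0 !mulr1 subrK divr1 mulr0 addr0 addNr.
  (* The derivative given by [d1] is the square of [t' - 2^-1]. *)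
  by set t' := _ / Z t; have := sqr_ge0 (t' - 2^-1); lra.
have := nonneg_of_derive d2 g1.
rewrite {1}/Z oppr0 expR0 mulr1 subrK ln1 subr0 !mulr0 addr0 => /(_ erefl x x0).
rewrite subr_ge0 -ler_expR lnK ?posrE //.
by rewrite [8^-1 * _]mulrC.
Qed.

(* Chernoff's method, with the exponent x = 4 (n q - 1) / n. *)
Lemma card_few_hits (R : realType) (n r : nat) (Z : {set 'I_n * 'I_r}) :
  (0 < r)%N -> (r <= n)%N -> (forall i, exists j, (i, j) \in Z) ->
  #|[set f : {ffun 'I_n -> 'I_r} | (#|[set i | (i, f i) \in Z]| <= 1)%N]|%:R
  <= (r ^ n)%:R * expR (- (2 * (n%:R - r%:R) ^+ 2) / (n%:R * r%:R ^+ 2)) :> R.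
Proof.
move=> r0 rn Zi.
have n0 : (0 : R) < n%:R by rewrite ltr0n (leq_trans r0).
have r0' : (0 : R) < r%:R by rewrite ltr0n.
have rn' : (r%:R : R) <= n%:R by rewrite ler_nat.
pose q : R := r%:R^-1.
have q0 : 0 < q by rewrite invr_gt0.
have q1 : q <= 1 by rewrite invf_le1 // ler1n.
pose x : R := 4 * (n%:R * q - 1) / n%:R.
have x0 : 0 <= x.
  rewrite divr_ge0 ?(ltW n0) // mulr_ge0 // subr_ge0 ler_pdivlMr // mul1r //.
pose F (i : 'I_n) (j : 'I_r) : R := if (i, j) \in Z then expR (- x) else 1.
have F0 i j : 0 <= F i j by rewrite /F; case: ifP => _; rewrite ?expR_ge0.
(* At least one label of [i] is a hit, so the mean of [F i] over a uniform label is at most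
   [1 - q + q * expR (- x)]. *)
have sumF i : \sum_j F i j <= r%:R * expR (- q * x + x ^+ 2 / 8).
  apply: (@le_trans _ _ (r%:R * (1 - q + q * expR (- x)))); last first.
    by rewrite ler_pM2l // hoeffding_bernoulli.
  have [j ijZ] := Zi i.
  rewrite (bigD1 j) //= {1}/F ijZ.
  have -> : r%:R * (1 - q + q * expR (- x)) = expR (- x) + (r%:R - 1).
    by rewrite /q; field; rewrite lt0r_neq0.
  rewrite lerD2l (@le_trans _ _ (\sum_(j' | j' != j) 1)) //.
    apply: ler_sum => j' _; rewrite /F; case: ifP => // _.
    by rewrite -expR0 ler_expR oppr_le0.
  by rewrite sumr_const cardC1 card_ord -subn1 natrB.
have sumall : \sum_(f : {ffun 'I_n -> 'I_r}) \prod_i F i (f i)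
    <= (r ^ n)%:R * expR (n%:R * (- q * x + x ^+ 2 / 8)).
  rewrite -(bigA_distr_bigA F) natrX mulrC expRM_natl mulrC -exprMn.
  rewrite -[X in _ ^+ X]card_ord -prodr_const.
  by apply: ler_prod => i _; rewrite sumF andbT; apply: sumr_ge0.
have hit (f : {ffun 'I_n -> 'I_r}) :
    \prod_i F i (f i) = expR (- x) ^+ #|[set i | (i, f i) \in Z]|.
  rewrite -prodr_const [RHS]big_mkcond /=; apply: eq_bigr => i _.
  by rewrite /F inE.
(* The exponent [x + n (- q x + x^2 / 8)] is minimal at the chosen [x], with value
   [- 2 (n q - 1)^2 / n]. *)
have eE : expR (- x) ^+ 1 * expR (- (2 * (n%:R - r%:R) ^+ 2) / (n%:R * r%:R ^+ 2))
    = expR (n%:R * (- q * x + x ^+ 2 / 8)).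
  rewrite expr1 -expRD; congr expR; rewrite /x /q.
  by field; rewrite !lt0r_neq0.
rewrite -(ler_pM2l (expR_gt0 (- x))) [leRHS]mulrCA -[X in X * expR _]expr1 eE.
apply: le_trans sumall.
rewrite mulrC mulr_natl -sumr_const.
apply: (@le_trans _ _ (\sum_(f in [set f : {ffun 'I_n -> 'I_r} |
    (#|[set i | (i, f i) \in Z]| <= 1)%N]) \prod_i F i (f i))).
  (* With at most one hit the product is at least [expR (- x)], because [expR (- x) <= 1]. *)
  apply: ler_sum => f; rewrite inE hit => /ler_wiXn2l.
  rewrite -{2}[expR (- x)]expr1; apply; first exact: expR_ge0.
  by rewrite -expR0 ler_expR oppr_le0.
rewrite [leRHS](bigID (mem [set f : {ffun 'I_n -> 'I_r} |
    (#|[set i | (i, f i) \in Z]| <= 1)%N])) /= lerDl.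
by apply: sumr_ge0 => f _; apply: prodr_ge0.
Qed.

(** * Label partitions, partition distance, and neighbours by relabelling one point *)

Definition relabel (n r : nat) (f : {ffun 'I_n -> 'I_r}) (k : 'I_n) (j : 'I_r) :
    {ffun 'I_n -> 'I_r} :=
  [ffun i => if i == k then j else f i].

Lemma label_classP (n r : nat) (f : {ffun 'I_n -> 'I_r}) (B : {set 'I_n}) :
  reflect (exists2 j, B = [set i | f i == j] & B != set0) (B \in label_partition f).
Proof.
rewrite in_setD1; apply: (iffP andP) => [[B0 /imsetP[j _ BE]]|[j BE B0]]; first by exists j.
by split => //; rewrite BE; exact: imset_f.
Qed.

Lemma label_partition_partition (n r : nat) (f : {ffun 'I_n -> 'I_r}) :
  partition (label_partition f) [set: 'I_n].
Proof.
apply/and3P; split.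
- apply/eqP/setP => i; rewrite inE; apply/bigcupP.
  exists [set i' | f i' == f i]; last by rewrite inE.
  by apply/label_classP; exists (f i) => //; apply/set0Pn; exists i; rewrite inE.
- apply/trivIsetP => _ _ /label_classP[j -> _] /label_classP[j' -> _] neq.
  rewrite -setI_eq0; apply: contraNT neq => /set0Pn[i].
  by rewrite !inE => /andP[/eqP <- /eqP <-].
- by apply/negP => /label_classP[j _]; rewrite eqxx.
Qed.

Lemma card_label_partition (n r : nat) (f : {ffun 'I_n -> 'I_r}) :
  (forall j, exists i, f i = j) -> #|label_partition f| = r.
Proof.
move=> fs.
have -> : label_partition f = [set [set i | f i == j] | j : 'I_r].
  apply/setP => B; apply/label_classP/imsetP => [[j -> _]|[j _ ->]]; first by exists j.
  by exists j => //; apply/set0Pn; have [i <-] := fs j; exists i; rewrite inE.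
rewrite card_imset ?card_ord // => j j' /setP e.
by have [i ij] := fs j; have := e i; rewrite !inE ij eqxx => /esym/eqP.
Qed.

Lemma label_partition_eq (n r : nat) (f g : {ffun 'I_n -> 'I_r}) :
  label_partition f = label_partition g -> forall a b, (f a == f b) = (g a == g b).
Proof.
suff h (f' g' : {ffun 'I_n -> 'I_r}) : label_partition f' = label_partition g' ->
    forall a b, f' a == f' b -> g' a == g' b.
  by move=> e a b; apply/idP/idP; apply: h.
move=> e a b fab.
have : [set i | f' i == f' a] \in label_partition g'.
  rewrite -e; apply/label_classP; exists (f' a) => //.
  by apply/set0Pn; exists a; rewrite inE.
case/label_classP => j /setP h _; have := h a; have := h b.
by rewrite !inE eqxx (eq_sym (f' b)) fab => /esym/eqP -> /esym/eqP ->.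
Qed.

Lemma mem_restrict_partP (n : nat) (P : {set {set 'I_n}}) (Y C : {set 'I_n}) :
  reflect (exists2 B, B \in P & C = B :&: Y /\ C != set0) (C \in restrict_part P Y).
Proof.
rewrite in_setD1; apply: (iffP andP) => [[C0 /imsetP[B BP CE]]|[B BP [CE C0]]].
  by exists B.
by split => //; rewrite CE; exact: imset_f.
Qed.

Lemma restrict_part_setT (n : nat) (P : {set {set 'I_n}}) :
  set0 \notin P -> restrict_part P setT = P.
Proof.
move=> P0; apply/setP => C; apply/mem_restrict_partP/idP => [[B BP [-> _]]|CP].
  by rewrite setIT.
by exists C => //; split; [rewrite setIT | apply: contraNneq P0 => <-].
Qed.

Lemma restrict_label_partition (n r : nat) (f g : {ffun 'I_n -> 'I_r}) (Y : {set 'I_n}) :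
  {in Y, f =1 g} ->
  restrict_part (label_partition f) Y = restrict_part (label_partition g) Y.
Proof.
suff h (f' g' : {ffun 'I_n -> 'I_r}) : {in Y, f' =1 g'} ->
    restrict_part (label_partition f') Y \subset restrict_part (label_partition g') Y.
  by move=> e; apply/eqP; rewrite eqEsubset !h // => i iY; rewrite e.
move=> e; apply/subsetP => _ /mem_restrict_partP[_ /label_classP[j -> _] [-> /set0Pn C0]].
have eI : [set i | f' i == j] :&: Y = [set i | g' i == j] :&: Y.
  apply/setP => i; rewrite !inE; case: (boolP (i \in Y)) => [/e ->//|_].
  by rewrite !andbF.
apply/mem_restrict_partP; exists [set i | g' i == j].
  apply/label_classP; exists j => //; apply/set0Pn; case: C0 => i.
  by rewrite eI inE => /andP[]; exists i.
by rewrite eI; split => //; apply/set0Pn; rewrite -eI.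
Qed.

Lemma part_dist_le (n : nat) (P P' : {set {set 'I_n}}) (X : {set 'I_n}) :
  restrict_part P (~: X) = restrict_part P' (~: X) -> (part_dist P P' <= #|X|)%N.
Proof.
move=> /eqP e; rewrite /part_dist; have := mem_index_enum X.
elim: (index_enum _) => //= Z s IH; rewrite inE big_cons => /predU1P[<-|/IH h].
  by rewrite e geq_minl.
by case: ifP => // _; apply: leq_trans (geq_minr _ _) h.
Qed.

Lemma part_dist_attained (n : nat) (P P' : {set {set 'I_n}}) :
  exists2 X : {set 'I_n}, restrict_part P (~: X) = restrict_part P' (~: X)
    & part_dist P P' = #|X|.
Proof.
rewrite /part_dist; apply: (big_ind (fun m => exists2 X : {set 'I_n},
    restrict_part P (~: X) = restrict_part P' (~: X) & m = #|X|)).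
(* The default value [n] is attained by removing every point, which leaves nothing of either
   partition. *)
- exists setT; last by rewrite cardsT card_ord.
  have r0 (Q : {set {set 'I_n}}) : restrict_part Q (~: setT) = set0.
    apply/setP => C; rewrite [RHS]inE; apply/negP => /mem_restrict_partP[B _ []].
    by rewrite setCT setI0 => ->; rewrite eqxx.
  by rewrite !r0.
- by move=> a b ha hb; rewrite /minn; case: ifP.
- by move=> X /eqP; exists X.
Qed.

(** Since blocks are nonempty, distance 0 forces equality; distance 1 therefore means distinct
    partitions that agree off a single point. *)
Lemma part_dist_eq1 (n : nat) (P P' : {set {set 'I_n}}) :
  partition P [set: 'I_n] -> partition P' [set: 'I_n] ->
  part_dist P P' = 1%N <->
  P <> P' /\ exists k, restrict_part P [set~ k] = restrict_part P' [set~ k].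
Proof.
move=> /and3P[_ _ P0] /and3P[_ _ P'0]; split=> [d1|[neq [k e]]].
  split=> [e|].
    have := @part_dist_le _ P P' set0; rewrite d1 cards0 e => /(_ erefl); by [].
  have [X e] := part_dist_attained P P'; rewrite d1 => /esym/eqP/cards1P[k kX].
  by exists k; rewrite -kX.
apply/eqP; have := part_dist_le e; rewrite cards1 => le1.
rewrite eqn_leq le1 lt0n; apply/eqP => d0; case: neq.
have [X] := part_dist_attained P P'; rewrite d0 => e' /esym/cards0_eq X0.
by move: e'; rewrite X0 setC0 !restrict_part_setT.
Qed.

(** Every class has a point other than [k]; such a point of class [j] is joined by [k] only after
    the relabelling. *)
Lemma relabel_partition_neq (n r : nat) (f : {ffun 'I_n -> 'I_r}) k j :
  (forall k j, exists2 i, i != k & f i = j) ->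
  j != f k ->
  label_partition f <> label_partition (relabel f k j).
Proof.
move=> f_two jk /label_partition_eq; have [b bk bj] := f_two k j.
by move=> /(_ b k); rewrite !ffunE eqxx (negPf bk) bj eqxx (negPf jk).
Qed.

(** A witness [b] of class [j] shares a block with [k] in the first partition. If [k = k'], sharing
    it in the second forces [j = j']; if [k] and [k'] differ, choosing [b] other than [k'] leaves
    [b] and [k] apart in the second. *)
Lemma relabel_partition_inj (n r : nat) (f : {ffun 'I_n -> 'I_r}) k j k' j' :
  (forall k j, exists2 i, i != k & f i = j) ->
  j != f k -> j' != f k' ->
  label_partition (relabel f k j) = label_partition (relabel f k' j') ->
  (k, j) = (k', j').
Proof.
move=> f_two jk jk' /label_partition_eq e.
have [kk|kk] := eqVneq k k'.
  subst k'; have [b bk bj] := f_two k j.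
  by have := e b k; rewrite !ffunE eqxx (negPf bk) bj eqxx => /esym/eqP ->.
have [b bk' bj] := f_two k' j.
have bk : b != k by apply: contraNneq jk => <-; rewrite bj.
have := e b k; rewrite !ffunE eqxx (negPf bk) (negPf bk') (negPf kk) bj eqxx.
by rewrite (negPf jk).
Qed.

(** Deleting [k] keeps the [r] classes nonempty and distinct, so the [r] blocks of [P'] are these
    classes with [k] put back into one of them; the index of that class is the new label. *)
Lemma relabel_of_restrict_eq (n r : nat) (f : {ffun 'I_n -> 'I_r}) (P' : {set {set 'I_n}}) k :
  (forall k j, exists2 i, i != k & f i = j) ->
  is_partition_r r P' ->
  restrict_part (label_partition f) [set~ k] = restrict_part P' [set~ k] ->
  exists j, P' = label_partition (relabel f k j).
Proof.
move=> f_two /andP[partP' /eqP cP'] e.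
have [/eqP covP' trivP' P'0] := and3P partP'.
pose E j := [set i | f i == j] :\ k.
have E0 j : E j != set0.
  by have [i ik ij] := f_two k j; apply/set0Pn; exists i; rewrite !inE ik ij eqxx.
have restE : restrict_part P' [set~ k] = [set E j | j : 'I_r].
  rewrite -e; apply/setP => C; apply/mem_restrict_partP/imsetP.
    by case=> _ /label_classP[j -> _] [-> _]; exists j => //; rewrite /E setDE.
  case=> j _ ->; exists [set i | f i == j]; last by rewrite -setDE; split => //; exact: E0.
  apply/label_classP; exists j => //; have [i ij] := set0Pn _ (E0 j).
  by apply/set0Pn; exists i; move: ij; rewrite !inE => /andP[].
have cE : #|[set E j | j : 'I_r]| = r.
  rewrite card_imset ?card_ord // => j j' /setP ejj'.
  have [i] := set0Pn _ (E0 j); move=> ij; have := ij; rewrite ejj'.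
  by move: ij; rewrite !inE => /andP[_ /eqP ->] /andP[_ /eqP].
(* As P' has only r blocks, none of them can vanish when k is removed. *)
have P'E B : B \in P' -> exists j, B :\ k = E j.
  move=> BP'; suff : B :\ k \in restrict_part P' [set~ k].
    by rewrite restE => /imsetP[j _]; exists j.
  rewrite setDE /restrict_part in_setD1 (imset_f (fun B => B :&: [set~ k]) BP') andbT.
  apply/negP => /eqP B0.
  have := leq_imset_card (fun B => B :&: [set~ k]) P'.
  rewrite cP' -[X in (_ <= X)%N]cE -restE /restrict_part.
  rewrite [X in (X <= _)%N](cardsD1 set0) -{1}B0.
  by rewrite (imset_f (fun B => B :&: [set~ k]) BP') add1n ltnn.
have kcov : k \in cover P' by rewrite covP' inE.
have [B0P' kB0] : pblock P' k \in P' /\ k \in pblock P' k.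
  by rewrite pblock_mem // mem_pblock.
have [j B0E] := P'E _ B0P'; exists j.
(* Both partitions have [r] blocks, so one inclusion suffices. *)
apply/eqP; rewrite eqEcard cP' card_label_partition ?leqnn ?andbT; last first.
  by move=> j'; have [i ik ij] := f_two k j'; exists i; rewrite ffunE (negPf ik).
apply/subsetP => B BP'.
have [j' BE] := P'E _ BP'.
apply/label_classP; exists j'; last by apply: contraNneq P'0 => <-.
have [kB|kB] := boolP (k \in B).
  have BB0 : B = pblock P' k by rewrite (def_pblock trivP' BP' kB).
  have jj' : j' = j.
    have [i] := set0Pn _ (E0 j'); move=> ij; have := ij.
    rewrite -BE BB0 B0E; move: ij.
    by rewrite !inE => /andP[_ /eqP ->] /andP[_ /eqP].
  apply/setP => i; rewrite inE ffunE jj'; have [->|ik] := eqVneq i k.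
    by rewrite kB eqxx.
  by move/setP/(_ i): BE; rewrite jj' !inE ik.
(* Otherwise [B] and the block of [k] would share the nonempty set [E j]. *)
have jj' : j' != j.
  apply: contraNneq kB => jj'.
  have [i] := set0Pn _ (E0 j'); move=> ij.
  have iB : i \in B by move: ij; rewrite -BE inE => /andP[].
  have iB0 : i \in pblock P' k by move: ij; rewrite jj' -B0E inE => /andP[].
  by rewrite -(def_pblock trivP' BP' iB) (def_pblock trivP' B0P' iB0).
apply/setP => i; rewrite inE ffunE; have [->|ik] := eqVneq i k.
  by rewrite (negPf kB) eq_sym (negPf jj').
by move/setP/(_ i): BE; rewrite !inE ik.
Qed.

(** The pairs [(k, j)] with [j != f k] number [n * (r - 1)], and relabelling maps them bijectively
    onto the neighbours of the partition. *)
Lemma degree_of_robust (R : realType) (n r d : nat) (p : 'I_n -> 'rV[R]_d)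
    (f : {ffun 'I_n -> 'I_r}) :
  (forall k j, exists2 i, i != k & f i = j) ->
  (forall k j, tverberg_partition p r (label_partition (relabel f k j))) ->
  tverberg_degree p r (label_partition f) = (n * (r - 1))%N.
Proof.
move=> f_two tv; pose A := [set kj : 'I_n * 'I_r | kj.2 != f kj.1].
have -> : (n * (r - 1) = #|A|)%N.
  have -> : #|A| = (\sum_i \sum_(j | j != f i) 1)%N by rewrite pair_big_dep /= sum1dep_card.
  rewrite (eq_bigr (fun=> r.-1)) => [|i _]; last by rewrite sum1_card cardC1 card_ord.
  by rewrite sum_nat_const card_ord subn1.
have inj : {in A &, injective (fun kj => label_partition (relabel f kj.1 kj.2))}.
  by move=> [k j] [k' j'] /=; rewrite !inE /=; exact: (relabel_partition_inj f_two).
rewrite -(card_in_imset inj); congr #|pred_of_set _|.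
apply/setP => P'; rewrite inE; apply/andP/imsetP.
  case=> /asboolP tP' /eqP; case: (tP') => partP' _.
  rewrite part_dist_eq1 ?label_partition_partition //; last by case/andP: partP'.
  case=> neq [k e]; have [j jE] := relabel_of_restrict_eq f_two partP' e.
  exists (k, j) => //; rewrite inE /=; apply: contra_notN neq => /eqP jk.
  by rewrite jE; congr label_partition; apply/ffunP => i; rewrite ffunE jk; case: eqP => [->|].
case=> [[k j]]; rewrite inE /= => jk ->; split; first exact/asboolP.
apply/eqP/part_dist_eq1; rewrite ?label_partition_partition //; split.
  exact: (relabel_partition_neq f_two).
exists k; apply: restrict_label_partition => i; rewrite !inE => ik.
by rewrite ffunE (negPf ik).
Qed.

(** * Sarkaria's tensor trick and robust labellings *)

(* The vertices - (e_1 + ... + e_r), e_1, ..., e_r of a simplex centred at the origin. *)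
Definition simplex_vertex (R : pzRingType) (r : nat) (j : 'I_r.+1) : 'cV[R]_r :=
  \col_a ((j == lift ord0 a)%:R - (j == ord0)%:R).

(* Sarkaria's tensor of the homogeneous point (p_i, 1) with the j-th simplex vertex. *)
Definition sarkaria (R : pzRingType) (n d r : nat) (p : 'I_n -> 'rV[R]_d)
    (ij : 'I_n * 'I_r.+1) : 'rV[R]_(r * (d + 1)) :=
  mxvec (simplex_vertex R ij.2 *m row_mx (p ij.1) 1).

Lemma sum_simplex_vertex (R : pzRingType) (r : nat) :
  \sum_(j < r.+1) simplex_vertex R j = 0.
Proof.
apply/colP => a; rewrite summxE mxE.
under eq_bigr do rewrite mxE.
rewrite sumrB (bigD1 (lift ord0 a)) //= eqxx big1 => [|j /negPf -> //].
by rewrite (bigD1 ord0) //= big1 => [|j /negPf -> //]; rewrite subrr.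
Qed.

Lemma sum_sarkaria (R : realFieldType) (n d r : nat) (p : 'I_n -> 'rV[R]_d) i :
  \sum_(j < r.+1) sarkaria p (i, j) = 0.
Proof. by rewrite -linear_sum /= -mulmx_suml sum_simplex_vertex mul0mx linear0. Qed.

Definition nonpos_pattern (R : realFieldType) (n d r : nat) (p : 'I_n -> 'rV[R]_d) u :
    {set 'I_n * 'I_r.+1} :=
  [set t | dot (sarkaria p t) u <= 0].

(** The vectors of one point sum to zero, so a functional cannot be positive on all of them. *)
Lemma nonpos_pattern_row (R : realFieldType) (n d r : nat) (p : 'I_n -> 'rV[R]_d) u i :
  exists j : 'I_r.+1, (i, j) \in nonpos_pattern p u.
Proof.
apply/existsP; apply: contraT; rewrite negb_exists => /forallP h.
have : 0 < \sum_(j < r.+1) dot (sarkaria p (i, j)) u.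
  have h' (j : 'I_r.+1) : 0 < dot (sarkaria p (i, j)) u.
    by rewrite ltNge; have := h j; rewrite inE.
  by rewrite big_ord_recl ltr_pwDl // sumr_ge0 // => j _; exact: ltW.
by rewrite -dot_suml sum_sarkaria dot0l ltxx.
Qed.

Lemma card_nonpos_patterns (R : realType) (n d r : nat) (p : 'I_n -> 'rV[R]_d) :
  (0 < n)%N -> (0 < d)%N ->
  (#|[set Z : {set 'I_n * 'I_r.+1} | `[< exists u, Z = nonpos_pattern p u >]]|
    <= (n * r.+1) ^ (r * (d + 1)))%N.
Proof.
move=> n0 d0; apply: (leq_trans (card_le_shattered _)).
set F := [set Z | _].
apply: (@leq_trans #|[set A : {set 'I_n * 'I_r.+1} | (#|A| <= r * (d + 1))%N]|).
  apply: subset_leq_card; apply/subsetP => A; rewrite !inE => /shattersP sh.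
  apply: (@card_shattered_halfspaces _ _ _ (sarkaria p)) => B /sh[Z].
  rewrite inE => /asboolP[u ->] <-; exists u => t tA.
  by rewrite !inE tA andbT.
rewrite card_subsets_le card_prod !card_ord.
(* With a single label the exponent is 0 and both sides are 1; otherwise the exponent and the size
   of the ground set are both at least 2. *)
case: r {F p} => [|r]; first by rewrite mul0n big_ord_recl big_ord0 bin0 expn0.
by apply: sum_bin_le_expn; nia.
Qed.

Definition robust (R : realType) (n d r : nat) (p : 'I_n -> 'rV[R]_d)
    (f : {ffun 'I_n -> 'I_r.+1}) : Prop :=
  forall k, exists w : 'I_n -> R, [/\ forall i, 0 <= w i, w k = 0, 0 < \sum_i w i
    & \sum_i w i *: sarkaria p (i, f i) = 0].

(** Gordan's theorem is applied to all points but the [k] where robustness fails: a functional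
    strictly positive on their vectors leaves only [k] for the half-space. *)
Lemma not_robust_pattern (R : realType) (n d r : nat) (p : 'I_n -> 'rV[R]_d)
    (f : {ffun 'I_n -> 'I_r.+1}) :
  ~ robust p f -> exists u, (#|[set i | (i, f i) \in nonpos_pattern p u]| <= 1)%N.
Proof.
move/existsNP => [k hk].
have [[u us]|[w [w0 ws wS wy]]] := gordan (enum [set~ k]) (fun i => sarkaria p (i, f i)).
  exists u; rewrite -(cards1 k); apply: subset_leq_card; apply/subsetP => i.
  rewrite !inE; apply: contraLR => ik; rewrite -ltNge; apply: us.
  by rewrite mem_enum !inE.
by case: hk; exists w; split=> //; apply: ws; rewrite mem_enum !inE eqxx.
Qed.

(** Row [a] of the tensor equation says that the weighted sums over the classes [lift ord0 a] and
    [ord0] coincide. *)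
Lemma sarkaria_dependency (R : realType) (n d r : nat) (p : 'I_n -> 'rV[R]_d)
    (f : {ffun 'I_n -> 'I_r.+1}) (w : 'I_n -> R) :
  \sum_i w i *: sarkaria p (i, f i) = 0 ->
  forall j j' : 'I_r.+1,
    \sum_(i | f i == j) w i *: row_mx (p i) (1 : 'rV_1)
    = \sum_(i | f i == j') w i *: row_mx (p i) (1 : 'rV_1).
Proof.
move=> wy.
suff h (j : 'I_r.+1) : \sum_(i | f i == j) w i *: row_mx (p i) (1 : 'rV_1)
    = \sum_(i | f i == ord0) w i *: row_mx (p i) (1 : 'rV_1).
  by move=> j j'; rewrite (h j) (h j').
have [a ->|->//] := unliftP ord0 j.
have : \sum_i w i *: (simplex_vertex R (f i) *m row_mx (p i) (1 : 'rV_1)) = 0.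
  apply: (can_inj mxvecK); rewrite linear0 -[RHS]wy linear_sum.
  by apply: eq_bigr => i _; rewrite linearZ.
move/(congr1 (row a)); rewrite linear0 linear_sum /= => e.
apply/eqP; rewrite -subr_eq0; apply/eqP; rewrite -[RHS]e.
rewrite [X in X - _]big_mkcond [X in _ - X]big_mkcond -sumrB; apply: eq_bigr => i _.
rewrite linearZ /= row_mul.
have -> : row a (simplex_vertex R (f i)) =
    ((f i == lift ord0 a)%:R - (f i == ord0)%:R)%:M.
  by rewrite [LHS]mx11_scalar !mxE.
rewrite mul_scalar_mx scalerBl scalerBr.
by do 2!case: eqP => _; rewrite ?scale1r ?scale0r ?scaler0.
Qed.

(** The homogeneous coordinate gives every class the same weight [S], positive because [r.+1] copies
    of it make up the total; the other coordinates give a common weighted sum [x]. So [S^-1 *: x]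
    lies in every hull, and points of weight zero may be relabelled freely. *)
Lemma tverberg_of_dependency (R : realType) (n d r : nat) (p : 'I_n -> 'rV[R]_d)
    (f : {ffun 'I_n -> 'I_r.+1}) (w : 'I_n -> R) :
  (forall i, 0 <= w i) -> 0 < \sum_i w i -> \sum_i w i *: sarkaria p (i, f i) = 0 ->
  (forall j, exists2 i, w i != 0 & f i = j) /\
  (forall g : {ffun 'I_n -> 'I_r.+1}, (forall i, w i != 0 -> g i = f i) ->
     tverberg_partition p r.+1 (label_partition g)).
Proof.
move=> w0 wS /sarkaria_dependency dep.
pose S := \sum_(i | f i == ord0) w i.
pose x := \sum_(i | f i == ord0) w i *: p i.
have depj j : \sum_(i | f i == j) w i = S /\ \sum_(i | f i == j) w i *: p i = x.
  have := dep j ord0.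
  have sumE j' : \sum_(i | f i == j') w i *: row_mx (p i) (1 : 'rV_1)
     = row_mx (\sum_(i | f i == j') w i *: p i) ((\sum_(i | f i == j') w i)%:M).
    rewrite -[LHS]hsubmxK !linear_sum /=; congr row_mx.
      by apply: eq_bigr => i _; rewrite linearZ /= row_mxKl.
    rewrite -scalemx1 scaler_suml.
    by apply: eq_bigr => i _; rewrite linearZ /= row_mxKr.
  rewrite !sumE => /eq_row_mx[-> /(congr1 (fun M : 'M_1 => M 0 0))].
  by rewrite !mxE !mulr1n.
have S0 : 0 < S.
  have : \sum_i w i = r.+1%:R * S.
    rewrite (partition_big f xpredT) //= (eq_bigr (fun=> S)) => [|j _]; last by case: (depj j).
    by rewrite sumr_const card_ord mulr_natl.
  by move=> e; move: wS; rewrite e pmulr_rgt0 // ltr0n.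
have onto j : exists2 i, w i != 0 & f i = j.
  have [/eqP + _] := depj j; rewrite -subr_eq0 => e.
  have : [exists i, (w i != 0) && (f i == j)].
    apply: contraLR S0; rewrite negb_exists => /forallP h.
    have [<- _] := depj j; rewrite big1 ?ltxx // => i fij.
    by have := h i; rewrite fij andbT negbK => /eqP.
  by case/existsP => i /andP[? /eqP ?]; exists i.
split=> // g gf.
have sumg (V : nmodType) j (h : 'I_n -> V) : (forall i, w i = 0 -> h i = 0) ->
    \sum_(i | g i == j) h i = \sum_(i | f i == j) h i.
  move=> h0; rewrite big_mkcond [RHS]big_mkcond; apply: eq_bigr => i _.
  have [/h0 ->|/gf ->//] := eqVneq (w i) 0; by rewrite !if_same.
split.
  rewrite /is_partition_r label_partition_partition card_label_partition ?eqxx //.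
  by move=> j; have [i /gf + <-] := onto j; exists i.
exists (S^-1 *: x) => B /label_classP[j BE _].
have wB i : (if i \in B then S^-1 * w i else 0) = if g i == j then S^-1 * w i else 0.
  by rewrite BE inE.
have [sj xj] := depj j.
exists (fun i => if i \in B then S^-1 * w i else 0); split.
- by move=> i; case: ifP => // _; rewrite mulr_ge0 // invr_ge0 ltW.
- by move=> i /negPf ->.
- rewrite (eq_bigr _ (fun i _ => wB i)) -big_mkcond -mulr_sumr sumg ?sj //.
  by rewrite mulVf // gt_eqF.
- rewrite (eq_bigr (fun i => if g i == j then S^-1 *: (w i *: p i) else 0)); last first.
    by move=> i _; rewrite wB scalerA; case: ifP => // _; rewrite scale0r.
  rewrite -big_mkcond -scaler_sumr sumg ?xj // => i ->; by rewrite scale0r.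
Qed.

(** A dependency avoiding [k] is unaffected by the label of [k], and it has a point of nonzero
    weight, hence other than [k], in every class. *)
Lemma robust_good (R : realType) (n d r : nat) (p : 'I_n -> 'rV[R]_d)
    (f : {ffun 'I_n -> 'I_r.+1}) :
  (0 < n)%N -> robust p f ->
  tverberg_partition p r.+1 (label_partition f) /\
  tverberg_degree p r.+1 (label_partition f) = (n * (r.+1 - 1))%N.
Proof.
move=> n0 rob.
have tv k (g : {ffun 'I_n -> 'I_r.+1}) : (forall i, i != k -> g i = f i) ->
    tverberg_partition p r.+1 (label_partition g).
  move=> gf; have [w [w0 wk wS wy]] := rob k.
  have [_ +] := tverberg_of_dependency w0 wS wy; apply=> i wi; apply: gf.
  by apply: contraNneq wi => ->; rewrite wk.
split; first by apply: (tv (Ordinal n0)).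
apply: degree_of_robust => [k j|k j].
  have [w [w0 wk wS wy]] := rob k.
  have [/(_ j)[i wi fij] _] := tverberg_of_dependency w0 wS wy.
  by exists i => //; apply: contraNneq wi => ->; rewrite wk.
by apply: (tv k) => i ik; rewrite ffunE (negPf ik).
Qed.

(** * Counting the labellings that are not robust, and the conclusion *)

Lemma card_not_robust (R : realType) (n d r : nat) (p : 'I_n -> 'rV[R]_d) :
  (0 < n)%N -> (0 < d)%N -> (r.+1 <= n)%N ->
  #|[set f : {ffun 'I_n -> 'I_r.+1} | ~~ `[< robust p f >]]|%:R
  <= ((n * r.+1) ^ (r * (d + 1)))%:R * ((r.+1 ^ n)%:R *
     expR (- (2 * (n%:R - r.+1%:R) ^+ 2) / (n%:R * r.+1%:R ^+ 2))) :> R.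
Proof.
move=> n0 d0 rn.
pose F := [set Z : {set 'I_n * 'I_r.+1} | `[< exists u, Z = nonpos_pattern p u >]].
pose few (Z : {set 'I_n * 'I_r.+1}) :=
  [set f : {ffun 'I_n -> 'I_r.+1} | (#|[set i | (i, f i) \in Z]| <= 1)%N].
(* Union bound over the half-space patterns. *)
apply: (@le_trans _ _ (#|\bigcup_(Z in F) few Z|%:R)).
  rewrite ler_nat; apply: subset_leq_card; apply/subsetP => f; rewrite inE => /asboolPn.
  case/not_robust_pattern => u hu; apply/bigcupP; exists (nonpos_pattern p u).
    by rewrite inE; apply/asboolP; exists u.
  by rewrite inE.
apply: (@le_trans _ _ (\sum_(Z in F) #|few Z|%:R)).
  rewrite -natr_sum ler_nat; elim/big_rec2: _ => [|Z m B _ IH]; first by rewrite cards0.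
  by apply: leq_trans (leq_card_setU _ _) _; rewrite leq_add2l.
set h := _ * expR _.
apply: (@le_trans _ _ (\sum_(Z in F) h)).
  apply: ler_sum => Z; rewrite inE => /asboolP[u ->].
  by apply: card_few_hits => // i; exact: nonpos_pattern_row.
rewrite sumr_const -[h *+ _]mulr_natl ler_wpM2r ?ler_nat ?card_nonpos_patterns //.
by rewrite mulr_ge0 ?expR_ge0.
Qed.

(** Here [r >= 2], so the powers contribute at least [r^2], and it remains to bound the exponential
    below by [r^-2]. Its exponent is at least its value at [n = 1], and
    [exp (- t^2) >= 1 - t^2 >= 1 / r] for [t = (r - 1) / r]; squaring this gives the bound. *)
Lemma bound_vacuous (R : realType) (n r d : nat) :
  (0 < n)%N -> (0 < d)%N -> (n < r)%N ->
  1 <= r%:R ^+ ((r - 1) * (d + 1)) * n%:R ^+ ((r - 1) * (d + 1))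
        * expR (- (2 * (n%:R - r%:R) ^+ 2) / (n%:R * r%:R ^+ 2)) :> R.
Proof.
move=> n0 d0 nr.
have n1 : (1 : R) <= n%:R by rewrite ler1n.
have r1 : (n%:R : R) + 1 <= r%:R by rewrite natr1 ler_nat.
set N : R := n%:R in n1 r1 *; set r' : R := r%:R in r1 *.
have r0 : 0 < r' by lra.
have D2 : (2 <= (r - 1) * (d + 1))%N by nia.
have e1 : r' ^+ 2 <= r' ^+ ((r - 1) * (d + 1)) * N ^+ ((r - 1) * (d + 1)).
  rewrite -[leLHS]mulr1; apply: ler_pM => //; first exact/exprn_ge0/ltW.
    by rewrite ler_eXn2l //; lra.
  exact: exprn_ege1.
have e2 : expR (- (2 * (r' - 1) ^+ 2) / r' ^+ 2)
    <= expR (- (2 * (N - r') ^+ 2) / (N * r' ^+ 2)).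
  have -> : - (2 * (N - r') ^+ 2) / (N * r' ^+ 2) = - (2 * (N - r') ^+ 2) / N / r' ^+ 2.
    by field; rewrite !lt0r_neq0 //; lra.
  rewrite ler_expR ler_wpM2r ?invr_ge0 ?sqr_ge0 //.
  have N0 : 0 < N by lra.
  have h1 : (N - r') ^+ 2 <= (r' - 1) ^+ 2 by nra.
  have h2 : (r' - 1) ^+ 2 <= N * (r' - 1) ^+ 2 by rewrite ler_peMl ?sqr_ge0.
  by rewrite ler_pdivlMr //; lra.
have e3 : r'^-1 ^+ 2 <= expR (- (2 * (r' - 1) ^+ 2) / r' ^+ 2).
  have -> : - (2 * (r' - 1) ^+ 2) / r' ^+ 2 = 2%:R * - ((r' - 1) / r') ^+ 2.
    by field; rewrite lt0r_neq0.
  rewrite expRM_natl ler_sqr ?nnegrE ?expR_ge0 ?invr_ge0 ?(ltW r0) //.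
  apply: le_trans (expR_ge1Dx _).
  have -> : 1 + - ((r' - 1) / r') ^+ 2 = r'^-1 + r'^-1 * ((r' - 1) / r').
    by field; rewrite lt0r_neq0.
  rewrite lerDl mulr_ge0 ?invr_ge0 ?divr_ge0 ?(ltW r0) //; lra.
apply: (@le_trans _ _ (r' ^+ 2 * r'^-1 ^+ 2)).
  by rewrite exprVn mulfV // expf_neq0 // lt0r_neq0.
apply: ler_pM => //; rewrite ?exprn_ge0 ?invr_ge0 ?(ltW r0) //.
exact: le_trans e2.
Qed.

Theorem theorem1p7 (R : realType) (n r d : nat) (p : 'I_n -> 'rV[R]_d) :
  (0 < n)%N -> (0 < r)%N -> (0 < d)%N -> injective p ->
  1 - (r%:R ^+ ((r - 1) * (d + 1)) * n%:R ^+ ((r - 1) * (d + 1)))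
        * expR (- (2 * (n%:R - r%:R) ^+ 2) / (n%:R * r%:R ^+ 2))
  <= prob_good r p.
Proof.
move=> n0 r0 d0 _.
(* The tail bound requires [r <= n]; for [n < r] the claimed lower bound is nonpositive. *)
have [nr|rn] := ltnP n r.
  apply: (@le_trans _ _ 0); first by rewrite subr_le0 bound_vacuous.
  by rewrite divr_ge0.
case: r r0 rn => // r _ rn.
rewrite /prob_good ler_pdivlMr ?ltr0n ?expn_gt0 //.
set h := expR _.
have := card_not_robust p n0 d0 rn; rewrite -/h subn1 /=.
set bad := [set f | _] => badle.
(* The robust labellings, all of them good, form the complement of [bad]. *)
apply: (@le_trans _ _ (#|~: bad|%:R)).
  have cb : #|~: bad|%:R = (r.+1 ^ n)%:R - #|bad|%:R :> R.
    have := cardsC bad; rewrite card_ffun !card_ord => <-.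
    by rewrite natrD addrC addKr.
  rewrite cb; move: badle; rewrite natrX natrM exprMn.
  set a := r.+1%:R ^+ _; set b := n%:R ^+ _; set c := (_ ^ n)%:R.
  by lra.
rewrite ler_nat; apply: subset_leq_card; apply/subsetP => f.
rewrite !inE negbK => /asboolP rob; apply/asboolP.
by have := robust_good n0 rob; rewrite subn1.
Qed.
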